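(* Let $(X,d)$ be a complete, connected, locally compact, non-compact geodesic space. Assume the pseudo-metric $\rho:X\times X\to\mathbb{R}$, $\rho(x_0,x_1)=-\frac12[u_{x_0}(x_1)+u_{x_1}(x_0)]$, vanishes everywhere, i.e. $\rho(x_0,x_1)=0$ for any $x_0,x_1\in X$. Then, up to additive constants, there is only one dl-function on $X$.
   Context: A geodesic space is a length space in which the distance between any two points is attained by the length of some Lipschitz curve connecting them. For a non-empty closed set $H\subseteq X$, $d(x,H)=\inf_{h\in H}d(x,h)$. A function $u:X\to\mathbb{R}$ is a dl-function if there are a sequence of (non-empty) closed subsets $H_n\subseteq X$ diverging to infinity (i.e. $d(x_0,H_n)\to\infty$ for some $x_0\in X$) and real numbers $c_n$ such that $u(x)=\lim_{n\to\infty}[d(x,H_n)-c_n]$, the limit being in the compact-open topology (uniform on compact sets). For $x_0\in X$ and $r>0$ let $S_r(x_0)=\{x\in X: d(x,x_0)=r\}$; then $u_{x_0}:X\to\mathbb{R}$ is defined by $u_{x_0}(x)=\lim_{r\to+\infty}[d(x,S_r(x_0))-r]$ (this limit exists for every $x$). *)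

(* Defs.v *)
From HB Require Import structures.
From mathcomp Require Import all_boot all_order all_algebra.
From mathcomp Require Import all_classical all_reals all_analysis.
Import Order.TTheory GRing.Theory Num.Theory.
Import numFieldNormedType.Exports.

Set Implicit Arguments.
Unset Strict Implicit.
Unset Printing Implicit Defensive.

Local Open Scope classical_set_scope.
Local Open Scope ring_scope.

(* [cauchy_cvg] as a predicate: the library has no structure joining metricType
   with completeness, and states [cvg F] for pointed types only. *)
Definition complete_space (X : uniformType) : Prop :=
  forall F : set_system X, ProperFilter F -> cauchy F -> exists x : X, F --> x.

Section Metric.
Variables (R : realType) (X : metricType R).
Implicit Types (a b k r : R) (x y : X) (g : R -> X) (H : set X).

(* [lipschitz _ | _ in _] requires normed modules, hence this version. *)
Definition lipschitz_curve a b g : Prop :=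
  exists k, forall s t, s \in `[a, b] -> t \in `[a, b] ->
    mdist (g s) (g t) <= k * `|s - t|.

(* Metric-valued analogues of [variation] and [total_variation]: p lists the
   points of a subdivision of [a, b] other than a itself. *)
Definition polygonal_length a b g (p : seq R) : R :=
  let F := g \o nth b (a :: p) in
  \sum_(0 <= n < size p) mdist (F n) (F n.+1).

Definition curve_length a b g : \bar R :=
  ereal_sup [set (polygonal_length a b g p)%:E | p in itv_partition a b].

Definition joins a b g x y : Prop :=
  [/\ a <= b, lipschitz_curve a b g, g a = x & g b = y].

Definition length_space : Prop :=
  forall x y, (mdist x y)%:E =
    ereal_inf [set l | exists a b g, joins a b g x y /\ l = curve_length a b g].

Definition geodesic_space : Prop :=
  length_space /\
  forall x y, exists a b g,
    joins a b g x y /\ curve_length a b g = (mdist x y)%:E.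

Definition dist_to x H : R := inf [set mdist x h | h in H].

Definition dl_function (u : X -> R) : Prop :=
  exists (H : nat -> set X) (c : nat -> R),
    [/\ forall n, closed (H n) /\ H n !=set0,
        exists x0, (fun n => dist_to x0 (H n)) @ \oo --> +oo &
        {compact-open, (fun n (x : X) => dist_to x (H n) - c n) @ \oo --> u}].

Definition metric_sphere x0 r : set X := [set x | mdist x x0 = r].

(* [lim] is the actual limit when X is complete, connected, locally compact,
   non-compact and geodesic. *)
Definition u_ x0 x : R :=
  lim ((fun r => dist_to x (metric_sphere x0 r) - r) @ +oo).

Definition rho x0 x1 : R := - (1 / 2) * (u_ x0 x1 + u_ x1 x0).

End Metric.

(* Main.v *)
(* Geodesics from [x] to a far away set [H] must cross the sphere [S_r(x0)], so
   d(x, S_r(x0)) - r <= d(x, H) - d(x0, H).  For [H] a larger sphere this gives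
   monotonicity in [r], hence the existence of [u_ x0 x]; for [H = H_n] it
   gives [u_ x0 x <= v x - v x0] for every dl-function [v].  When [rho]
   vanishes, exchanging [x] and [x0] yields the reverse inequality, so
   [v - v x0 = u_ x0].  Spheres of all radii are nonempty because, by
   Hopf-Rinow, a bounded [X] would be compact. *)
Require Import Defs.
From mathcomp Require Import all_boot all_order all_algebra.
From mathcomp Require Import all_classical all_reals all_analysis.
From mathcomp Require Import lra.
Import Order.TTheory GRing.Theory Num.Theory.
Import numFieldNormedType.Exports.
Local Open Scope classical_set_scope.
Local Open Scope ring_scope.

Set Implicit Arguments.
Unset Strict Implicit.

(** * Distance functions to sets and compact-open convergence *)

Section DistanceToSet.
Context {R : realType} {X : metricType R}.
Implicit Types (x y : X) (H : set X) (r : R).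

Lemma mdist_image_has_inf x H : H !=set0 -> has_inf [set mdist x h | h in H].
Proof.
move=> [h Hh]; split; first by exists (mdist x h), h.
by exists 0 => _ [z _ <-]; exact: mdist_ge0.
Qed.

Lemma dist_to_le x h H : H h -> dist_to x H <= mdist x h.
Proof.
move=> Hh; have [_ lbH] := @mdist_image_has_inf x H (ex_intro _ h Hh).
by apply: ge_inf => //; exists h.
Qed.

Lemma le_dist_to x H r :
  H !=set0 -> (forall h, H h -> r <= mdist x h) -> r <= dist_to x H.
Proof.
move=> [h Hh] rH; apply: lb_le_inf => [|_ [z Hz <-]]; last exact: rH.
by exists (mdist x h), h.
Qed.

Lemma dist_to_triangle x y H :
  H !=set0 -> dist_to x H <= mdist x y + dist_to y H.
Proof.
move=> H0; rewrite -lerBlDl; apply: le_dist_to => // h Hh.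
by rewrite lerBlDl (le_trans (dist_to_le x Hh))// metric_triangle.
Qed.

Lemma dist_to_lipschitz x y H :
  H !=set0 -> `|dist_to x H - dist_to y H| <= mdist x y.
Proof.
move=> H0; rewrite ler_norml lerBlDr dist_to_triangle// andbT.
by rewrite lerBrDr addrC lerBlDr addrC metric_sym dist_to_triangle.
Qed.

Lemma mdist_lipschitz x y z : `|mdist x z - mdist y z| <= mdist x y.
Proof.
rewrite ler_norml lerBlDr metric_triangle andbT.
by rewrite lerBrDr addrC lerBlDr addrC (metric_sym x y) metric_triangle.
Qed.

Lemma mdist_continuous z : continuous (fun x => mdist x z).
Proof.
move=> x; apply/cvgrPdist_le => e e0; near=> y.
rewrite (le_trans (mdist_lipschitz _ _ _))// ltW//.
by near: y; have := nbhsx_ballx x e e0; rewrite ballEmdist.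
Unshelve. all: by end_near. Qed.

Lemma closed_metric_sphere x r : closed (metric_sphere x r).
Proof.
rewrite (_ : metric_sphere x r = (fun y => mdist y x) @^-1` [set r])//.
by apply: closed_comp => [y _|]; [exact: mdist_continuous|exact: closed_eq].
Qed.

Definition closed_mball x r : set X := [set y | mdist y x <= r].

Lemma closed_closed_mball x r : closed (closed_mball x r).
Proof.
rewrite (_ : closed_mball x r = (fun y => mdist y x) @^-1` [set s | s <= r])//.
by apply: closed_comp => [y _|]; [exact: mdist_continuous|exact: closed_le].
Qed.

(** Near a point the values of all [F n] vary by less than e/2 on one common ball, so the
    near-covering form of compactness yields a single threshold for all of [K]. *)
Lemma equilipschitz_compact_open (F : nat -> X -> R) (u : X -> R) :
  (forall n x y, `|F n x - F n y| <= mdist x y) ->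
  (forall x, F n x @[n --> \oo] --> u x) ->
  {compact-open, F @ \oo --> u}.
Proof.
move=> Flip Fu; apply/compact_open_cvgP => K O /compact_near_coveringP cK oO uO.
suff: \forall n \near \oo, K `<=` (fun x => O (F n x)).
  apply: filterS => n KO _ [x Kx <-]; exact: KO.
apply: (cK nat _ (fun n x => O (F n x))) => x Kx.
have /nbhs_ballP[e /= e0 eO] : nbhs (u x) O.
  by apply: open_nbhs_nbhs; split => //; apply: uO; exists x.
have e20 : 0 < e / 2 by rewrite divr_gt0.
near=> y n; apply: eO.
rewrite /ball/= (splitr e) (le_lt_trans (ler_distD (F n x) _ _))// ltrD//.
  near: n; by move/cvgrPdist_lt : (Fu x); apply.
rewrite (le_lt_trans (Flip _ _ _))//.
by near: y; have := nbhsx_ballx x _ e20; rewrite ballEmdist.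
Unshelve. all: by end_near. Qed.

Lemma compact_open_pointwise (F : nat -> X -> R) (u : X -> R) x :
  {compact-open, F @ \oo --> u} -> F n x @[n --> \oo] --> u x.
Proof.
move=> /compact_open_cvgP Fu A; rewrite nbhsE => -[V [oV Vu] VA].
have uV : u @` [set x] `<=` V by move=> _ [_ -> <-].
have : \forall n \near \oo, F n @` [set x] `<=` V.
  exact: (Fu _ _ (@compact_set1 _ x) oV uV).
by apply: filterS => n FV; apply/VA/FV; exists x.
Qed.

End DistanceToSet.

(** * Geodesics crossing spheres *)

Section GeodesicSpaces.
Context {R : realType} {X : metricType R}.
Hypothesis hgeodesic : geodesic_space X.
Implicit Types (x y z : X) (r : R).

Lemma mdist_le_curve_length a b (g : R -> X) t : t \in `[a, b] ->
  ((mdist (g a) (g t) + mdist (g t) (g b))%:E <= curve_length a b g)%E.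
Proof.
rewrite in_itv/= => /andP[].
(* Subdivisions are strictly increasing, so [t] can be inserted as an interior point only when it
   differs from both ends. *)
rewrite le_eqVlt => /predU1P[<-|a_t]; last rewrite le_eqVlt => /predU1P[tb|tb].
- rewrite mdistxx add0r le_eqVlt => /predU1P[<-|ab].
    rewrite mdistxx; apply: ereal_sup_ubound; exists [::].
      by split => //=.
    by rewrite /polygonal_length big_nil.
  apply: ereal_sup_ubound; exists [:: b]; first exact: itv_partition1.
  by rewrite /polygonal_length /= big_nat1.
- rewrite -tb mdistxx addr0; apply: ereal_sup_ubound; exists [:: t].
    exact: itv_partition1.
  by rewrite /polygonal_length /= big_nat1.
- apply: ereal_sup_ubound; exists [:: t; b]; first by split; rewrite //= a_t tb.
  by rewrite /polygonal_length /= big_nat_recr//= big_nat1.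
Qed.

(** The distance to [z] is continuous along a minimizing curve, so it takes the value [r]; the curve
    point where it does so splits the length without excess. *)
Lemma geodesic_meets_sphere x y z r : mdist x z <= r <= mdist y z ->
  exists2 s, metric_sphere z r s & mdist x s + mdist s y <= mdist x y.
Proof.
move=> /andP[xr ry].
have [a [b [g [[ab [k glip] gax gby] glen]]]] := hgeodesic.2 x y.
have fcont : {within `[a, b], continuous (fun t => mdist (g t) z)}.
  apply/subspace_continuousP => t tab; apply/cvgrPdist_le => e e0.
  (* The Lipschitz constant [k] may be zero or negative, hence the divisor. *)
  have d0 : 0 < e / (`|k| + 1) by rewrite divr_gt0// ltr_wpDl.
  near=> s.
  have sab : s \in `[a, b] by near: s; exact: withinT.
  rewrite (le_trans (mdist_lipschitz _ _ _))// (le_trans (glip _ _ tab sab))//.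
  rewrite (@le_trans _ _ ((`|k| + 1) * `|t - s|))//.
    by rewrite ler_wpM2r// (le_trans (ler_norm k))// lerDl.
  rewrite mulrC -ler_pdivlMr ?ltr_wpDl// ltW//.
  near: s; apply: cvg_within; exact: (nbhsx_ballx t _ d0).
have [|t tab ftr] := IVT ab fcont (v := r).
  by rewrite gax gby ge_min xr le_max ry orbT.
exists (g t) => //.
by have := mdist_le_curve_length g tab; rewrite glen gax gby lee_fin.
Unshelve. all: by end_near. Qed.

End GeodesicSpaces.

(** * Compactness of closed balls *)

Section HopfRinow.
Context {R : realType} {X : metricType R}.
Hypothesis hgeodesic : geodesic_space X.
Implicit Types (x y z : X) (r : R).

Lemma compact_closed_mball_extend x r : locally_compact [set: X] -> 0 <= r ->
  compact (closed_mball x r) ->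
  exists2 d, 0 < d & compact (closed_mball x (r + d)).
Proof.
move=> hlc r0 /compact_near_coveringP cB.
pose D := [set p : set X * R | compact p.1 /\ 0 < p.2].
pose G := filter_from D (fun p => [set q | D q /\ p.1 `<=` q.1 /\ q.2 <= p.2]).
have GF : Filter G.
  apply: filter_from_filter.
    by exists (set0, 1); split => //=; exact: compact0.
  move=> [C1 d1] [C2 d2] /= [cC1 d10] [cC2 d20].
  exists (C1 `|` C2, Num.min d1 d2).
    by split => /=; [exact: compactU|rewrite lt_min d10].
  move=> [C d] [Dq /= [+ +]]; rewrite subUset le_min => -[? ?] /andP[? ?].
  by [].
(* The pairs (C, d) with C growing among compact sets and d decreasing to 0
   form a filter, along which the near-covering form of compactness gives a
   single C that contains a uniform neighborhood of the ball. *)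
have : \forall q \near G,
    closed_mball x r `<=` (fun y => closed_mball y q.2 `<=` q.1).
  apply: (cB _ G (fun q y => closed_mball y q.2 `<=` q.1)) => y _.
  have [U Uy [cU _]] := hlc y I.
  have /nbhs_ballP[e /= e0 eU] : nbhs y U.
    have : nbhs y [set z | [set: X] z -> U z] := Uy.
    by apply: filterS => z; apply.
  have e20 : 0 < e / 2 by rewrite divr_gt0.
  exists (ball y (e / 2), [set q | D q /\ U `<=` q.1 /\ q.2 <= e / 2]).
    split; first exact: nbhsx_ballx.
    by exists (U, e / 2).
  move=> [z [C d]] /= [yz [_ /= [UC de]]] w /= wz.
  apply/UC/eU; move: yz; rewrite !ballEmdist/= => yz.
  rewrite (le_lt_trans (metric_triangle _ z _))// (splitr e) ltr_leD//.
  by rewrite metric_sym (le_trans wz).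
move=> [[C d] [/= cC d0] /(_ (C, d))/= CB]; exists d => //.
have {}CB := CB (conj (conj cC d0) (conj (@subset_refl _ _) (lexx d))).
apply: (subclosed_compact (@closed_closed_mball _ _ _ _) cC) => y /= yx.
have [yr|ry] := leP (mdist y x) r.
  by apply: (CB y yr); rewrite /closed_mball/= mdistxx ltW.
(* A point [y] beyond radius [r] lies within [d] of the point [s] where a geodesic from [x] leaves
   the ball. *)
have [|s sr xsy] := @geodesic_meets_sphere _ _ hgeodesic x y x r.
  by rewrite mdistxx r0 ltW.
apply: (CB s); first by rewrite /closed_mball/= sr.
rewrite /closed_mball/= -(lerD2l r) (le_trans _ yx)//.
rewrite (metric_sym y x) (le_trans _ xsy)//.
by rewrite (metric_sym x s) sr (metric_sym y).
Qed.

(** Sliding points back along geodesics puts the ball within e/4 of a smaller compact ball. Hence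
    every ultrafilter on it is Cauchy, and completeness gives a limit. *)
Lemma compact_closed_mball_limit x r : complete_space X ->
  (forall t, 0 <= t < r -> compact (closed_mball x t)) ->
  0 < r -> compact (closed_mball x r).
Proof.
move=> hcomplete cB r0; rewrite compact_ultra => F FU FB.
have [p Fp] : exists p : X, F --> p.
  apply: hcomplete; apply: cauchy_exP => e e0.
  pose t := Num.max 0 (r - e / 4).
  have t0 : 0 <= t by rewrite le_max lexx.
  have tr : t < r by rewrite gt_max r0 ltrBlDr ltrDl divr_gt0.
  have proj y : exists z, closed_mball x r y ->
      mdist z x <= t /\ mdist z y <= e / 4.
    have [yB|nB] := pselect (closed_mball x r y); last by exists x.
    have [yt|ty] := leP (mdist y x) t.
      by exists y => _; rewrite mdistxx divr_ge0// ltW.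
    have [|s sr xsy] := @geodesic_meets_sphere _ _ hgeodesic x y x t.
      by rewrite mdistxx t0 ltW.
    exists s => _; rewrite sr; split=> //.
    rewrite -(lerD2l t) -{1}sr metric_sym (le_trans xsy)// metric_sym.
    by rewrite (le_trans yB)// -lerBlDr le_max lexx orbT.
  have [pi piP] := choice proj.
  (* A cluster point of the projected filter is a center for F at scale e. *)
  have : compact (closed_mball x t) by apply: cB; rewrite t0.
  move=> /(_ (pi @ F) _)[|z [_ zF]].
    suff : F (pi @^-1` closed_mball x t) by [].
    by apply: filterS FB => y yB; exact: (piP _ yB).1.
  exists z.
  (* Otherwise the complement of the ball is in [F], and clustering gives some [y] in it with [pi y]
     within e/4 of [z]; then [y] is within e/2 of [z], a contradiction. *)
  have [//|FnB] := in_ultra_setVsetC (ball z e) FU.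
  have e40 : 0 < e / 4 by rewrite divr_gt0.
  have [_ [[y [nzy yB] <-]]] := zF (pi @` (~` ball z e `&` closed_mball x r))
    _ (filterS (@preimage_image _ _ _ _) (filterI FnB FB))
    (nbhsx_ballx z _ e40).
  rewrite !ballEmdist/= in nzy * => zy; exfalso; apply: nzy.
  rewrite (le_lt_trans (metric_triangle _ (pi y) _))//.
  have -> : e = e / 4 + (e / 4 + e / 2) by lra.
  rewrite ltr_leD// (le_trans (piP _ yB).2)//.
  by rewrite lerDl divr_ge0// ltW.
exists p; split => //.
apply: (@closed_cvg _ _ F _ id (closed_mball x r)) => //.
exact: closed_closed_mball.
Qed.

(** If some ball were not compact, the radii of compact balls would have a finite supremum; it is
    attained by the limit lemma and exceeded by the extension lemma. *)
Lemma hopf_rinow x r : complete_space X -> locally_compact [set: X] ->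
  compact (closed_mball x r).
Proof.
move=> hcomplete hlc.
have mono s t : s <= t ->
    compact (closed_mball x t) -> compact (closed_mball x s).
  move=> st /subclosed_compact; apply; first exact: closed_closed_mball.
  by move=> y /= /le_trans; apply.
pose A := [set t | 0 <= t /\ compact (closed_mball x t)].
have A0 : A 0.
  split => //; suff -> : closed_mball x 0 = [set x] by exact: compact_set1.
  apply/seteqP; split=> [y /= y0|y ->]; last by rewrite /closed_mball/= mdistxx.
  by apply: mdist_positivity; apply/eqP; rewrite eq_le y0 mdist_ge0.
apply: contrapT => ncr.
have Aub : has_sup A.
  split; first by exists 0.
  exists r => t [_ ct]; rewrite leNgt; apply/negP => /ltW rt.
  exact/ncr/(mono _ _ rt).
have sA0 : 0 <= sup A by apply: sup_upper_bound.
have csup : compact (closed_mball x (sup A)).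
  move: sA0; rewrite le_eqVlt => /predU1P[<-|sA0]; first by case: A0.
  apply: compact_closed_mball_limit => // t /andP[t0 tA].
  have [|s [_ cs] ts] := @sup_adherent _ A (sup A - t) _ Aub.
    by rewrite subr_gt0.
  by apply: (mono _ s) => //; apply: ltW; move: ts; rewrite subKr.
have [d d0 cd] := compact_closed_mball_extend hlc sA0 csup.
have : A (sup A + d) by split => //; rewrite addr_ge0// ltW.
by move=> /(sup_upper_bound Aub); rewrite gerDl leNgt d0.
Qed.

Lemma metric_sphere_nonempty x r : complete_space X ->
  locally_compact [set: X] -> ~ compact [set: X] -> 0 <= r ->
  metric_sphere x r !=set0.
Proof.
move=> hcomplete hlc hnc r0.
have [y ry] : exists y, r < mdist y x.
  apply: contrapT => nry; apply: hnc.
  suff -> : [set: X] = closed_mball x r by exact: hopf_rinow.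
  apply/seteqP; split => // y _; rewrite /closed_mball/= leNgt.
  apply/negP => ry.
  by apply: nry; exists y.
have [|s sr _] := @geodesic_meets_sphere _ _ hgeodesic x y x r.
  by rewrite mdistxx r0 ltW.
by exists s.
Qed.

End HopfRinow.

(** * Limits of normalized distances to spheres and to diverging sets *)

Section BusemannLimits.
Context {R : realType} {X : metricType R}.
Hypothesis hgeodesic : geodesic_space X.
Implicit Types (x y z : X) (r : R).

Lemma dist_to_center x r :
  metric_sphere x r !=set0 -> dist_to x (metric_sphere x r) = r.
Proof.
move=> /[dup] S0 [h hr]; apply/eqP; rewrite eq_le; apply/andP; split.
  by rewrite -[leRHS]hr metric_sym; exact: dist_to_le.
by apply: le_dist_to => // s <-; rewrite metric_sym.
Qed.

(** If a geodesic from [y] to a point [h] of [H] crosses the sphere at [s], then d(s, h) is at least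
    d(x, h) - r. *)
Lemma dist_to_sphere_minorant x y H r :
  H !=set0 -> mdist y x <= r <= dist_to x H ->
  dist_to y (metric_sphere x r) - r + dist_to x H <= dist_to y H.
Proof.
move=> H0 /andP[yr rH]; apply: le_dist_to => // h Hh.
have xh := dist_to_le x Hh.
have [|s sr ysh] := @geodesic_meets_sphere _ _ hgeodesic y h x r.
  by rewrite yr metric_sym (le_trans rH).
have := dist_to_le y sr; have := metric_triangle x s h.
by rewrite (metric_sym x s) (sr : mdist s x = r); lra.
Qed.

Hypothesis hcomplete : complete_space X.
Hypothesis hloccompact : locally_compact [set: X].
Hypothesis hnoncompact : ~ compact [set: X].

Let sphere0 x r : 0 <= r -> metric_sphere x r !=set0.
Proof. exact: metric_sphere_nonempty. Qed.

Lemma u_cvg x y :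
  dist_to y (metric_sphere x r) - r @[r --> +oo] --> u_ x y.
Proof.
set f := fun r => dist_to y (metric_sphere x r) - r.
have [l fl] : exists l : R, f r @[r --> +oo] --> l; last first.
  by move/cvgP : fl.
(* [f] is monotone only from d(y, x) on. *)
pose g r := f (Num.max (mdist y x) r).
have max0 r : 0 <= Num.max (mdist y x) r by rewrite le_max mdist_ge0.
exists (sup (range g)).
suff : g r @[r --> +oo] --> sup (range g).
  apply: cvg_trans; apply: near_eq_cvg; near=> r.
  rewrite /g max_r//; near: r; exact: nbhs_pinfty_ge.
apply: (@nondecreasing_cvgr _ g) => [r s rs|].
  have rs' : Num.max (mdist y x) r <= Num.max (mdist y x) s.
    by rewrite ge_max !le_max lexx rs orbT.
  rewrite /g /f lerBrDr.
  (* The larger radius is the distance from [x] to the larger sphere, which plays the role of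
     [H]. *)
  rewrite -[X in _ + X <= _](dist_to_center (sphere0 x (max0 s))).
  apply: dist_to_sphere_minorant; first exact: sphere0.
  by rewrite le_max lexx/= dist_to_center//; exact: sphere0.
exists (mdist y x) => _ [r _ <-]; rewrite /g /f lerBlDr.
rewrite -[X in _ <= _ + X](dist_to_center (sphere0 x (max0 r))).
exact/dist_to_triangle/sphere0.
Unshelve. all: by end_near. Qed.

Lemma u_dl_function x : dl_function (u_ x).
Proof.
exists (fun n => metric_sphere x n%:R), (fun n => n%:R); split.
- by move=> n; split; [exact: closed_metric_sphere|exact: sphere0].
- exists x.
  suff -> : (fun n => dist_to x (metric_sphere x n%:R)) = GRing.natmul 1.
    exact: cvgr_idn.
  by apply/funext => n; exact/dist_to_center/sphere0.
- apply: equilipschitz_compact_open => [n y z|y].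
    rewrite opprB addrA subrK; exact/dist_to_lipschitz/sphere0.
  exact: (cvg_comp _ _ (@cvgr_idn R) (@u_cvg x y)).
Qed.

Lemma u_le_dl_function (v : X -> R) x y : dl_function v -> u_ x y <= v y - v x.
Proof.
move=> [H [c [clH [z Hoo] /compact_open_pointwise Fv]]].
have H0 n : H n !=set0 := (clH n).2.
(* Divergence is given from the base point [z]; moving to [x] costs at most d(z, x). *)
have Hx : dist_to x (H n) @[n --> \oo] --> +oo.
  apply/cvgryPge => M; near=> n.
  have := dist_to_triangle z x (H0 n).
  have : M + mdist z x <= dist_to z (H n).
    by near: n; move/cvgryPge : Hoo; apply.
  by lra.
apply: (cvgr_to_le (@u_cvg x y)).
near=> r.
(* With [r] fixed, [n] tends to infinity first; the constants [c n] cancel in the difference. *)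
apply: (cvgr_to_ge (cvgB (Fv y) (Fv x))).
near=> n.
have : dist_to y (metric_sphere x r) - r + dist_to x (H n) <= dist_to y (H n).
  apply: dist_to_sphere_minorant => //; apply/andP; split.
    by near: r; apply: nbhs_pinfty_ge; exact: num_real.
  by near: n; move/cvgryPge : Hx; apply.
by rewrite !fctE; lra.
Unshelve. all: by end_near. Qed.

End BusemannLimits.

Theorem theorem5p9 (R : realType) (X : metricType R)
    (hcomplete : complete_space X)
    (hconnected : connected [set: X])
    (hloccompact : locally_compact [set: X])
    (hnoncompact : ~ compact [set: X])
    (hgeodesic : geodesic_space X)
    (hrho : forall x0 x1 : X, rho x0 x1 = 0) :
  exists u : X -> R, dl_function u /\
    forall v : X -> R, dl_function v ->
      exists c : R, forall x : X, v x = u x + c.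
Proof.
(* The empty set is compact, so non-compactness supplies a base point. *)
have [x0 _] : [set: X] !=set0.
  by apply/set0P/eqP => X0; apply: hnoncompact; rewrite X0; exact: compact0.
exists (u_ x0); split; first exact: u_dl_function.
move=> v dlv; exists (v x0) => x.
have := hrho x0 x; rewrite /rho => rho0.
have le1 : u_ x0 x <= v x - v x0 by exact: u_le_dl_function.
have le2 : u_ x x0 <= v x0 - v x by exact: u_le_dl_function.
by lra.
Qed.
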